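(* For every fixed positive integer $k$, as $n\to\infty$, \[ \tilde{r}(K_{1,k},C_n)\le\left(\frac{2k+4}{5}+o(1)\right)n, \] where $o(1)$ denotes a quantity (which may depend on $k$) tending to $0$ as $n\to\infty$ with $k$ fixed.
   Context: The online Ramsey game for graphs $G$ and $H$ is played by two players, Builder and Painter, on the infinite complete graph $K_{\mathbb{N}}$ (vertex set $\mathbb{N}$). Initially no edge has been chosen. In each round, Builder chooses an edge not chosen before, and Painter immediately and irrevocably colors it red or blue. The online Ramsey number $\tilde{r}(G,H)$ is the smallest integer $t$ for which Builder has a strategy guaranteeing a red copy of $G$ or a blue copy of $H$ (as a not necessarily induced subgraph of the colored edges) within at most $t$ rounds, regardless of Painter's choices. $K_{1,k}$ is the star with $k$ edges and $C_n$ is the cycle on $n$ vertices. *)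

(* Defs.v *)
From HB Require Import structures.
From mathcomp Require Import all_boot.
From mathcomp Require Import boolp.

Set Implicit Arguments.
Unset Strict Implicit.
Unset Printing Implicit Defensive.

Record sgraph := SGraph {
  svertex : finType;
  sedge : rel svertex;
  sedge_sym : symmetric sedge;
  sedge_irrefl : irreflexive sedge }.

Definition star_rel (k : nat) : rel 'I_k.+1 :=
  fun u v => (u == ord0) (+) (v == ord0).

Lemma star_sym k : symmetric (@star_rel k).
Proof. by move=> u v; rewrite /star_rel addbC. Qed.

Lemma star_irrefl k : irreflexive (@star_rel k).
Proof. by move=> u; rewrite /star_rel addbb. Qed.

Definition star (k : nat) : sgraph := SGraph (@star_sym k) (@star_irrefl k).

(* [cycle_graph n] is the n-cycle only for n >= 3. *)
Definition cycle_rel (n : nat) : rel 'I_n :=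
  fun u v => (u != v) && ((v == u.+1 %[mod n]) || (u == v.+1 %[mod n])).

Lemma cycle_sym n : symmetric (@cycle_rel n).
Proof. by move=> u v; rewrite /cycle_rel eq_sym orbC. Qed.

Lemma cycle_irrefl n : irreflexive (@cycle_rel n).
Proof. by move=> u; rewrite /cycle_rel eqxx. Qed.

Definition cycle_graph (n : nat) : sgraph :=
  SGraph (@cycle_sym n) (@cycle_irrefl n).

(* An edge of the complete graph on nat is encoded as the pair of its
   endpoints in increasing order. *)
Definition edge := (nat * nat)%type.

Definition is_edge (e : edge) : bool := e.1 < e.2.

Definition mk_edge (x y : nat) : edge := (minn x y, maxn x y).

Definition red : bool := true.
Definition blue : bool := false.

(* The coloured edges in the order they were played, most recent first. *)
Definition history := seq (edge * bool).

Definition chosen (h : history) : seq edge := unzip1 h.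

Definition builder_strategy := history -> edge.

Definition painter_strategy := history -> edge -> bool.

Definition legal (sigma : builder_strategy) : Prop :=
  forall h, is_edge (sigma h) && (sigma h \notin chosen h).

Fixpoint play (sigma : builder_strategy) (pi : painter_strategy) (t : nat) :
    history :=
  if t is t'.+1 then
    let h := play sigma pi t' in (sigma h, pi h (sigma h)) :: h
  else [::].

Definition has_copy (G : sgraph) (c : bool) (h : history) : Prop :=
  exists2 f : svertex G -> nat, injective f &
    forall u v, sedge u v -> (mk_edge (f u) (f v), c) \in h.

Definition builder_wins (G H : sgraph) (t : nat) : Prop :=
  exists2 sigma, legal sigma &
    forall pi, exists2 s, s <= t &
      has_copy G red (play sigma pi s) \/ has_copy H blue (play sigma pi s).

Definition mono (c : rel nat) (b : bool) (S : seq nat) : Prop :=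
  {in S &, forall x y, x != y -> c x y = b}.

Lemma ramsey (a b : nat) : exists N, forall (c : rel nat) (A : seq nat),
  symmetric c -> uniq A -> N <= size A ->
  exists2 S, uniq S /\ {subset S <= A} &
    (size S = a /\ mono c red S) \/ (size S = b /\ mono c blue S).
Proof.
move: {2}(a + b) (leqnn (a + b)) => m.
elim: m a b => [|m IH] [|a] [|b] Hab //;
  try by exists 0 => c A _ _ _; exists [::] => //; (left + right).
have [N1 H1] : exists N, forall (c : rel nat) (A : seq nat),
  symmetric c -> uniq A -> N <= size A ->
  exists2 S, uniq S /\ {subset S <= A} &
    (size S = a /\ mono c red S) \/ (size S = b.+1 /\ mono c blue S).
  by apply: IH; rewrite addSn in Hab.
have [N2 H2] : exists N, forall (c : rel nat) (A : seq nat),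
  symmetric c -> uniq A -> N <= size A ->
  exists2 S, uniq S /\ {subset S <= A} &
    (size S = a.+1 /\ mono c red S) \/ (size S = b /\ mono c blue S).
  by apply: IH; rewrite addnS in Hab.
exists (N1 + N2).+1 => c [|x A] // csym /andP[xA uA] sA.
have ext d S : uniq S -> {subset S <= [seq y <- A | c x y == d]} ->
    mono c d S -> uniq (x :: S) /\ {subset x :: S <= x :: A} /\
    mono c d (x :: S).
  move=> uS sub mS; split.
    rewrite /= uS andbT; apply: contra xA => /sub.
    by rewrite mem_filter => /andP[].
  split.
    move=> y; rewrite !inE => /orP[->//|/sub].
    by rewrite mem_filter => /andP[_ ->]; rewrite orbT.
  move=> y z; rewrite !inE => /orP[/eqP->|yS] /orP[/eqP->|zS] yz.
  - by rewrite eqxx in yz.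
  - by move: (sub _ zS); rewrite mem_filter => /andP[/eqP].
  - by rewrite csym; move: (sub _ yS); rewrite mem_filter => /andP[/eqP].
  - exact: mS.
have subW d S : {subset S <= [seq y <- A | c x y == d]} -> {subset S <= x :: A}.
  by move=> sub y /sub; rewrite mem_filter inE => /andP[_ ->]; rewrite orbT.
have sz : size [seq y <- A | c x y == red] + size [seq y <- A | c x y == blue]
          = size A.
  rewrite -(count_predC (fun y => c x y == red) A) !size_filter; congr (_ + _).
  by apply: eq_count => y /=; case: (c x y).
have [le1|lt1] := leqP N1 (size [seq y <- A | c x y == red]).
  have [S [uS sub] [[sS mS]|[sS mS]]] := H1 c _ csym (filter_uniq _ uA) le1.
    have [? [? ?]] := ext _ _ uS sub mS.
    by exists (x :: S) => //; left; split; rewrite //= sS.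
  by exists S; [split=> //; exact: subW sub | right].
have le2 : N2 <= size [seq y <- A | c x y == blue].
  rewrite -(leq_add2l N1); apply: leq_trans (_ : size A <= _) => //.
  by rewrite -sz leq_add2r ltnW.
have [S [uS sub] [[sS mS]|[sS mS]]] := H2 c _ csym (filter_uniq _ uA) le2.
  by exists S; [split=> //; exact: subW sub | left].
have [? [? ?]] := ext _ _ uS sub mS.
by exists (x :: S) => //; right; split; rewrite //= sS.
Qed.

Lemma builder_wins_finite (G H : sgraph) : exists t, builder_wins G H t.
Proof.
have [N HN] := ramsey #|svertex G| #|svertex H|.
pose E := [seq e <- [seq (x, y) | x <- iota 0 N, y <- iota 0 N] | is_edge e].
have inE_ x y : x < N -> y < N -> x != y -> mk_edge x y \in E.
  move=> xN yN xy; rewrite mem_filter; apply/andP; split.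
    by rewrite /is_edge /= gtn_min !leq_max !ltnn orbF /= -neq_ltn.
  apply/allpairsP; exists (minn x y, maxn x y); split=> //;
    rewrite mem_iota leq0n add0n /=.
    by rewrite gtn_min xN.
  by rewrite gtn_max xN.
pose left_ h := [seq e <- E | e \notin chosen h].
pose sigma (h : history) : edge :=
  head (0, (\max_(e <- chosen h) e.2).+1) (left_ h).
have sigma_legal : legal sigma.
  move=> h; rewrite /sigma; case El: (left_ h) => [|e s] /=.
    rewrite /is_edge /=; apply/negP => hin.
    by have := @leq_bigmax_seq _ (chosen h) xpredT snd _ hin isT; rewrite ltnn.
  have: e \in left_ h by rewrite El mem_head.
  by rewrite !mem_filter => /and3P[-> ->].
exists (size E), sigma => // pi; exists (size E) => //.
have dec t : size (left_ (play sigma pi t)) <= size E - t.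
  elim: t => [|t IH].
    by rewrite subn0 size_filter; exact: count_size.
  rewrite /=; set h := play sigma pi t in IH *.
  set h' := _ :: h.
  have -> : left_ h' = [seq e <- left_ h | e != sigma h].
    rewrite /left_ -filter_predI; apply: eq_filter => e /=.
    by rewrite inE negb_or.
  case El: (left_ h) IH => [|e s] IH //.
  have -> : sigma h = e by rewrite /sigma El.
  rewrite /= eqxx /= subnS size_filter (leq_trans (count_size _ _)) //.
  by move: IH; case: (size E - t).
set h := play sigma pi (size E).
have all_chosen e : e \in E -> e \in chosen h.
  move=> eE; apply: contraT => ne.
  have: e \in left_ h by rewrite mem_filter ne.
  by have := dec (size E); rewrite subnn leqn0 size_eq0 -/h => /eqP->.
pose c : rel nat := fun x y => (mk_edge x y, red) \in h.
have csym : symmetric c by move=> x y; rewrite /c /mk_edge minnC maxnC.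
have emb (K : sgraph) (d : bool) S : uniq S -> {subset S <= iota 0 N} ->
    size S = #|svertex K| -> mono c d S -> has_copy K d h.
  move=> uS sub sS mS; exists (fun v => nth 0 S (enum_rank v)).
    move=> u v /eqP; rewrite nth_uniq ?sS ?ltn_ord // => /eqP/val_inj.
    exact: enum_rank_inj.
  move=> u v uv.
  set x := nth _ _ _; set y := nth _ _ _.
  have xS : x \in S by rewrite mem_nth ?sS.
  have yS : y \in S by rewrite mem_nth ?sS.
  have xy : x != y.
    rewrite nth_uniq ?sS ?ltn_ord //; apply/eqP => /val_inj/enum_rank_inj uv'.
    by move: uv; rewrite uv' sedge_irrefl.
  have := mS _ _ xS yS xy; rewrite /c; case: d {mS} => // nred.
  have := sub _ xS; have := sub _ yS; rewrite !mem_iota !add0n /= => yN xN.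
  have /mapP[[e b] hin /= eE] := all_chosen _ (inE_ _ _ xN yN xy).
  by rewrite eE in nred *; case: b hin nred => // ->.
have [|S [uS sub] [[sS mS]|[sS mS]]] := HN c (iota 0 N) csym (iota_uniq 0 N).
- by rewrite size_iota.
- by left; exact: emb sub sS mS.
- by right; exact: emb sub sS mS.
Qed.

Lemma builder_winsb_finite (G H : sgraph) : exists t, `[< builder_wins G H t >].
Proof. by have [t Ht] := builder_wins_finite G H; exists t; apply/asboolP. Qed.

Definition online_ramsey (G H : sgraph) : nat :=
  ex_minn (builder_winsb_finite G H).

Lemma online_ramseyP (G H : sgraph) :
  builder_wins G H (online_ramsey G H) /\
  forall t, builder_wins G H t -> online_ramsey G H <= t.
Proof.
rewrite /online_ramsey; case: ex_minnP => m /asboolP Hm min; split=> // t Ht.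
by apply: min; apply/asboolP.
Qed.

(* Main.v *)
Require Import Defs.
From mathcomp Require Import all_boot all_order all_algebra.
From mathcomp Require Import all_classical all_reals all_analysis.
From mathcomp Require Import zify ring lra.

Set Implicit Arguments.
Unset Strict Implicit.
Unset Printing Implicit Defensive.

(* Write k = d + 1; a vertex of red degree d is saturated, so every further
   edge at it must be blue.  Builder prepares teams of four vertices.  In a team
   the red degrees are raised evenly until a blue edge appears; the two other
   vertices are then attached to the two ends of that edge, each end being
   played against a vertex of at least its own red degree.  Two saturated
   vertices can instead be joined through a fresh vertex.  Thus a team becomes a
   blue path whose inner red degrees are dominated by those of its ends, all red
   edges so far joining team vertices and hence costing 1/2 per endpoint;
   saturating both ends with edges leaving the team brings the total number of
   red edges charged to it to at most 2d.  An edge is played only once, so the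
   same-degree vertices of different teams exchange their roles; this fails only
   when O(1) teams are left.

   A long blue path is built from the finished teams: its fresh end f is played
   against ends of different teams until it is extended (after at most d red
   edges, each charged to the team it hits), and the new end is then played
   against new vertices until a blue edge leads to a fresh end.  A team path with
   p >= 4 vertices thus accounts for p + 1 vertices and for at most
   2d + p + 1 <= (2d + 5)(p + 1)/5 edges.  Finally a new vertex u is joined to
   v_i and v_(i+n-2) for i < k, and one of these pairs closes a blue n-cycle. *)

(** * Builder's winning strategies as game trees *)

(** A branch that reaches a red star ends at once, whatever its length, so only the goal [G] has to
    carry a bound on the number of rounds; [force_size] recovers the bound for the other leaves. *)
Inductive force (d : nat) (G : history -> Prop) (h : history) : Prop :=
| force_now of G h
| force_star of has_copy (star d.+1) red h
| force_play e of is_edge e & e \notin chosen h &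
    forall c, force d G ((e, c) :: h).

Lemma has_copy_blueW (K : sgraph) e h :
  has_copy K red ((e, blue) :: h) -> has_copy K red h.
Proof.
case=> f finj fh; exists f => // u v uv.
by have := fh u v uv; rewrite inE => /orP[/eqP[]|].
Qed.

(** Along the branch on which every answer is blue no new red star appears, so this branch ends in
    [G] unless the star was there before; the history only grows on the way. *)
Lemma force_size d (G : history -> Prop) T h :
  (forall h', G h' -> size h' <= T) -> force d G h ->
  has_copy (star d.+1) red h \/ size h <= T.
Proof.
move=> GT; elim=> [{}h Gh|{}h sh|{}h e _ _ _ IH]; [by right; exact: GT|by left|].
have [/has_copy_blueW|/=] := IH blue; first by left.
by move=> /ltnW; right.
Qed.

(** Whenever a move that keeps [force] exists, one is picked by choice. As long as there is no win,
    [force] persists up to round [T]; one more blue answer then contradicts [force_size]. *)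
Lemma force_builder_wins d (H : sgraph) T :
  force d (fun h => has_copy H blue h /\ size h <= T) [::] ->
  builder_wins (star d.+1) H T.
Proof.
set G := (fun h : history => _) => F0.
pose good h e := [/\ is_edge e, e \notin chosen h &
                     forall c, force d G ((e, c) :: h)].
(* A default move: [legal] concerns all histories, also those without a good move. *)
pose unplayed (h : history) : edge := (0, (\max_(e <- chosen h) e.2).+1).
have unplayedP h : is_edge (unplayed h) && (unplayed h \notin chosen h).
  rewrite /is_edge /=; apply/negP => hin.
  by have := @leq_bigmax_seq _ (chosen h) xpredT snd _ hin isT; rewrite ltnn.
pose sigma h : edge :=
  if pselect (exists e, good h e) is left ex then projT1 (cid ex)
  else unplayed h.
have sigmaP h : (exists e, good h e) -> good h (sigma h).
  by rewrite /sigma => ex; case: pselect => // ex'; exact: (projT2 (cid ex')).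
exists sigma => [h|pi].
  rewrite /sigma; case: pselect => [ex|_]; last exact: unplayedP.
  by have [-> ->] := projT2 (cid ex).
apply: contrapT => nwin.
have sz t : size (play sigma pi t) = t by elim: t => //= t ->.
have Fplay t : t <= T -> force d G (play sigma pi t) ->
    forall c, force d G ((sigma (play sigma pi t), c) :: play sigma pi t).
  move=> tT [[Hh _]|sh|e ee eh Fe]; try by [case: nwin; exists t => //; auto].
  by have [] := sigmaP _ (ex_intro _ e (And3 ee eh Fe)).
have FT t : t <= T -> force d G (play sigma pi t).
  elim: t => // t IH tT; exact: (Fplay t (ltnW tT) (IH (ltnW tT))).
have [|/has_copy_blueW sh|/=] :=
  force_size (T := T) _ (Fplay T (leqnn T) (FT T (leqnn T)) blue).
- by move=> h [].
- by case: nwin; exists T => //; left.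
- by rewrite sz ltnn.
Qed.

(** * Red degrees, blue paths and fresh vertices *)

Definition inc (v : nat) (e : edge) : bool := (e.1 == v) || (e.2 == v).

Lemma inc_mk_edge v x y : inc v (mk_edge x y) = (x == v) || (y == v).
Proof. by rewrite /inc /mk_edge /=; case: (leqP x y) => // _; rewrite orbC. Qed.

Lemma mk_edgeC x y : mk_edge x y = mk_edge y x.
Proof. by rewrite /mk_edge minnC maxnC. Qed.

Lemma is_edge_mk x y : x != y -> is_edge (mk_edge x y).
Proof. rewrite /is_edge /mk_edge /=; lia. Qed.

Lemma mk_edge_inj x y z : mk_edge x y = mk_edge x z -> y = z.
Proof. by case; lia. Qed.

Definition wf (h : history) : bool :=
  uniq (chosen h) && all is_edge (chosen h).

(** The red degree of [v]; once it is [d], a further red edge at [v] completes the star. *)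
Definition lev (h : history) (v : nat) : nat :=
  count (fun ec => (ec.2 == red) && inc v ec.1) h.

(** Used through [nob_red]: every edge already played at such a vertex is red. *)
Definition nob (h : history) (v : nat) : bool :=
  all (fun ec => (ec.2 == blue) ==> ~~ inc v ec.1) h.

Definition bp (h : history) (P : seq nat) : bool :=
  sorted (fun x y => (mk_edge x y, blue) \in h) P.

Lemma star_of_neighbours d h x (l : seq nat) :
  d.+1 <= size l -> uniq l -> x \notin l ->
  (forall w, w \in l -> (mk_edge x w, red) \in h) ->
  has_copy (star d.+1) red h.
Proof.
move=> dl ul xl lh.
have xul : uniq (x :: l) by rewrite /= xl.
exists (fun i : 'I_d.+2 => nth 0 (x :: l) i) => [i j /eqP|].
  have lt (m : 'I_d.+2) : m < size (x :: l) by rewrite (leq_trans (ltn_ord m)).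
  by rewrite nth_uniq // => /eqP/val_inj.
have key (i j : 'I_d.+2) : i == ord0 -> j != ord0 ->
    (mk_edge (nth 0 (x :: l) i) (nth 0 (x :: l) j), red) \in h.
  move=> /eqP-> j0; apply: lh.
  by case: j j0 => -[|j] //= jd _; rewrite mem_nth // (leq_trans _ dl).
move=> i j /=; rewrite /star_rel.
case: (boolP (i == ord0)) => i0 /=; first exact: key.
by move=> j0; rewrite mk_edgeC; exact: key.
Qed.

Lemma star_of_lev d h x : wf h -> d < lev h x -> has_copy (star d.+1) red h.
Proof.
move=> /andP[uh eh] dlev.
pose other (e : edge) := if e.1 == x then e.2 else e.1.
pose F := [seq ec <- h | (ec.2 == red) && inc x ec.1].
have Fin ec : ec \in F ->
    [/\ ec \in h, ec.2 = red, is_edge ec.1 & ec.1 = mk_edge x (other ec.1)].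
  rewrite mem_filter => /andP[/andP[/eqP cr ix] hin].
  have ee : is_edge ec.1 by apply: (allP eh); apply: map_f.
  split=> //; move: ix ee; rewrite /inc /is_edge /other /mk_edge.
  case: (ec.1) => a b /=; case: eqP => [->|_] /=; first by move=> _ ab; congr pair; lia.
  by move=> /eqP-> ab; congr pair; lia.
apply: (@star_of_neighbours d h x [seq other ec.1 | ec <- F]).
- by rewrite size_map size_filter.
- have uF : uniq (unzip1 F).
    by apply: subseq_uniq uh; apply: map_subseq; exact: filter_subseq.
  rewrite map_inj_in_uniq; first exact: (map_uniq uF).
  move=> ec ec' /Fin[_ r _ E] /Fin[_ r' _ E'] oE.
  move: E E'; rewrite oE => <-.
  by case: ec ec' r r' {oE} => ? ? [? ?] /= -> -> <-.
- apply/negP => /mapP[ec /Fin[_ _ ee E] xo].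
  by move: ee; rewrite E -xo /is_edge /mk_edge /= minnn maxnn ltnn.
- move=> w /mapP[ec /Fin[hin r _ E] ->]; rewrite -E -r.
  by case: ec hin {r E}.
Qed.

Lemma lev_cons x y c h v :
  lev ((mk_edge x y, c) :: h) v =
  ((c == red) && ((x == v) || (y == v))) + lev h v.
Proof. by rewrite /lev /= inc_mk_edge. Qed.

Lemma nob_cons x y c h v :
  nob ((mk_edge x y, c) :: h) v =
  ((c == blue) ==> ~~ ((x == v) || (y == v))) && nob h v.
Proof. by rewrite /nob /= inc_mk_edge. Qed.

Lemma bp_sub h h' P : {subset h <= h'} -> bp h P -> bp h' P.
Proof. by move=> sub; apply: sub_sorted => x y /sub. Qed.

Lemma bp_rev h P : bp h (rev P) = bp h P.
Proof.
rewrite /bp rev_sorted; case: P => //= x P.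
by apply: eq_path => a b; rewrite mk_edgeC.
Qed.

Lemma bp_cons h x P :
  (0 < size P -> (mk_edge x (head 0 P), blue) \in h) -> bp h P -> bp h (x :: P).
Proof. by case: P => //= y P /(_ isT) -> ->. Qed.

Lemma bp_cat h P Q : 0 < size P -> 0 < size Q ->
  bp h P -> bp h Q -> (mk_edge (last 0 P) (head 0 Q), blue) \in h -> bp h (P ++ Q).
Proof. by case: P Q => // x P [|y Q] //= _ _; rewrite cat_path /= => -> -> ->. Qed.

(** Every vertex from [M] on is fresh, so [M] marks the supply of new vertices. *)
Definition bnd (M : nat) (h : history) : bool :=
  all (fun e : edge => e.2 < M) (chosen h).

Lemma wf_cons x y c h : x != y -> mk_edge x y \notin chosen h -> wf h ->
  wf ((mk_edge x y, c) :: h).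
Proof. by move=> xy nh /andP[uh eh]; rewrite /wf /= nh uh eh is_edge_mk. Qed.

Lemma bnd_cons M M' x y c h : x < M' -> y < M' -> M <= M' -> bnd M h ->
  bnd M' ((mk_edge x y, c) :: h).
Proof.
move=> xM yM MM hM; rewrite /bnd /= gtn_max xM yM /=.
by apply: sub_all hM => e eM; exact: leq_trans MM.
Qed.

Lemma unplayed_fresh M h x y : bnd M h -> M <= y -> mk_edge x y \notin chosen h.
Proof.
by move=> hM My; apply/negP => /(allP hM) /=; rewrite gtn_max => /andP[_]; lia.
Qed.

Lemma fresh_not_inc M h y ec :
  wf h -> bnd M h -> M <= y -> ec \in h -> ~~ inc y ec.1.
Proof.
case: ec => [[a b] c] /andP[_ eh] hM My hin.
have ein : (a, b) \in chosen h by apply: (map_f fst hin).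
have := allP hM _ ein; have := allP eh _ ein; rewrite /is_edge /inc /=; lia.
Qed.

Lemma lev_fresh M h y : wf h -> bnd M h -> M <= y -> lev h y = 0.
Proof.
move=> wh hM My; apply/eqP; rewrite -leqn0 leqNgt -has_count.
apply/hasPn => ec hin.
by rewrite negb_and (fresh_not_inc wh hM My hin) orbT.
Qed.

Lemma nob_fresh M h y : wf h -> bnd M h -> M <= y -> nob h y.
Proof.
move=> wh hM My; apply/allP => ec hin.
by rewrite (fresh_not_inc wh hM My hin) implybT.
Qed.

(** * Teams and their cost *)

(* A team consists of the active vertex, which is being played against the head
   of a blue path, of that path, and of the vertices not used yet.  These are
   two before the first blue edge (the path is then a single vertex), one while
   the first end of the blue edge is extended, none for the second end. *)
Definition team : Type := (nat * seq nat * seq nat)%type.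
Definition act (t : team) := t.1.1.
Definition pth (t : team) := t.1.2.
Definition rest (t : team) := t.2.
Definition supp (t : team) := act t :: pth t ++ rest t.

(** A merge takes one vertex out of [rest] and lengthens the path by one or two; both size
    inequalities survive this and leave three to five path vertices once [rest] is empty. The active
    vertex dominates the path end it faces, and a single waiting vertex dominates the other end.
    With two vertices waiting, each pair has equal levels and the pairs differ by at most one. *)
Definition okT (h : history) (t : team) : bool :=
  let x := act t in let P := pth t in
  [&& nob h x, all (nob h) (rest t), bp h P, 0 < size P,
      3 <= size P + size (rest t), size P + 2 * size (rest t) <= 5 &
      match rest t with
      | [::] => lev h (head 0 P) <= lev h x
      | [:: a] => (lev h (head 0 P) <= lev h x) && (lev h (last 0 P) <= lev h a)
      | [:: u; v] => [&& nob h (head 0 P) && (size P == 1), lev h (head 0 P) == lev h x,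
          lev h u == lev h v, lev h x <= lev h u & lev h u <= (lev h x).+1]
      | _ => false
      end].

(* [cost] and [costD] bound twice the number of edges charged to a team so far:
   a red edge between team vertices is charged to both endpoints. *)
Definition cost (h : history) (t : team) : nat :=
  let x := act t in let P := pth t in
  match rest t with
  | [::] => lev h x + lev h (head 0 P) + 2 * lev h (last 0 P) + 2 * (size P).-1
  | [:: a] =>
      lev h x + lev h (head 0 P) + lev h (last 0 P) + lev h a + 2 * (size P).-1
  | [:: u; v] => lev h x + lev h (head 0 P) + lev h u + lev h v
  | _ => 0
  end.

(** The last merge turns three to five path vertices into four to seven. *)
Definition okD (h : history) (P : seq nat) : bool :=
  bp h P && (4 <= size P <= 7).

Definition costD (h : history) (P : seq nat) : nat :=
  2 * (lev h (head 0 P) + lev h (last 0 P)) + 2 * (size P).-1.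

Lemma head_mem (P : seq nat) : 0 < size P -> head 0 P \in P.
Proof. by case: P => //= x P _; rewrite mem_head. Qed.

Lemma last_mem (P : seq nat) : 0 < size P -> last 0 P \in P.
Proof. by case: P => //= x P _; rewrite mem_last. Qed.

Lemma okT_frame h h' t : {subset h <= h'} ->
  {in supp t, lev h' =1 lev h} -> {in supp t, forall v, nob h v -> nob h' v} ->
  okT h t -> okT h' t.
Proof.
case: t => [[x P] r] sub lh nh; rewrite /okT /supp /= in lh nh *.
case/and5P=> nx nr bP P0 /and3P[s3 s5 m].
have inr v : v \in r -> v \in x :: P ++ r by rewrite inE mem_cat => ->; rewrite !orbT.
have inP v : v \in P -> v \in x :: P ++ r by rewrite inE mem_cat => ->; rewrite !orbT.
have [hx hH hL] : [/\ lev h' x = lev h x, lev h' (head 0 P) = lev h (head 0 P) &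
   lev h' (last 0 P) = lev h (last 0 P)].
  by split; apply: lh; rewrite ?mem_head //; apply: inP; rewrite ?head_mem ?last_mem.
apply/and5P; split=> //; [by apply: nh; rewrite ?mem_head| |exact: bp_sub bP|].
  by apply/allP => v vr; apply: nh; [exact: inr | exact: (allP nr)].
have lr v : v \in r -> lev h' v = lev h v by move=> /inr /lh.
have nH : nob h (head 0 P) -> nob h' (head 0 P).
  by apply: nh; apply: inP; rewrite head_mem.
rewrite s3 s5 hx hH hL /=; clear -m lr nH; case: r m lr => [|a [|b [|]]] //= m lr.
- by rewrite lr ?inE ?eqxx.
- by case/andP: m => /andP[/nH-> ->]; rewrite !lr ?inE ?eqxx ?orbT.
Qed.

Lemma cost_frame h h' t : {in supp t, lev h' =1 lev h} -> 0 < size (pth t) ->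
  cost h' t = cost h t.
Proof.
case: t => [[x P] r] lh P0; rewrite /cost /supp /= in lh P0 *.
have inr v : v \in r -> v \in x :: P ++ r by rewrite inE mem_cat => ->; rewrite !orbT.
have inP v : v \in P -> v \in x :: P ++ r by rewrite inE mem_cat => ->; rewrite !orbT.
have [hx hH hL] : [/\ lev h' x = lev h x, lev h' (head 0 P) = lev h (head 0 P) &
   lev h' (last 0 P) = lev h (last 0 P)].
  by split; apply: lh; rewrite ?mem_head //; apply: inP; rewrite ?head_mem ?last_mem.
have lr v : v \in r -> lev h' v = lev h v by move=> /inr /lh.
rewrite hx hH hL; clear -lr; case: r lr => [|a [|b [|]]] //= lr.
- by rewrite lr ?inE ?eqxx.
- by rewrite !lr ?inE ?eqxx ?orbT.
Qed.

(** * Configurations and the merging of the active vertex into its path *)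

Definition verts (U : seq team) (D : seq (seq nat)) (Q : seq nat) : seq nat :=
  flatten (map supp U) ++ flatten D ++ Q.

Record config (M : nat) (h : history) (U : seq team) (D : seq (seq nat))
    (Q : seq nat) : Prop := Config {
  config_wf : wf h;
  config_bnd : bnd M h;
  config_uniq : uniq (verts U D Q);
  config_lt : all (fun v => v < M) (verts U D Q);
  config_okT : all (okT h) U;
  config_okD : all (okD h) D;
  config_bp : bp h Q;
  config_gt0 : 0 < size Q }.

(** With one vertex left the path is reversed, so that this vertex faces the end not extended
    yet. *)
Definition merge (t : team) (P : seq nat) : seq team * seq (seq nat) :=
  match rest t with
  | [:: u; v] => ([:: (u, P, [:: v])], [::])
  | [:: a] => ([:: (a, rev P, [::])], [::])
  | _ => ([::], [:: P])
  end.

Lemma perm_merge t P : size (rest t) <= 2 ->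
  perm_eq (flatten (map supp (merge t P).1) ++ flatten (merge t P).2)
          (P ++ rest t).
Proof.
case: t => [[x P0] r]; rewrite /merge /supp /=.
case: r => [|a [|b [|]]] //= _; rewrite /= ?cats0 //; apply/permP => p;
  do 3 rewrite ?(count_cat, count_rev) /=; rewrite ?/act ?/pth /=; lia.
Qed.

Lemma all_okT_frame h h' U : {subset h <= h'} ->
  {in flatten (map supp U), lev h' =1 lev h} ->
  {in flatten (map supp U), forall v, nob h v -> nob h' v} ->
  all (okT h) U -> all (okT h') U.
Proof.
move=> sub lh nh /allP ok; apply/allP => t tU.
have inU v : v \in supp t -> v \in flatten (map supp U).
  by move=> vt; apply/flattenP; exists (supp t) => //; exact: map_f.
apply: okT_frame (ok t tU) => // v /inU; [exact: lh | exact: nh].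
Qed.

Lemma okT_gt0 h t : okT h t -> 0 < size (pth t).
Proof. by case/and5P. Qed.

Lemma all_cost_frame h h' U :
  {in flatten (map supp U), lev h' =1 lev h} -> all (okT h) U ->
  map (cost h') U = map (cost h) U.
Proof.
move=> lh /allP ok; apply/eq_in_map => t tU.
apply: cost_frame (okT_gt0 (ok t tU)) => v vt; apply: lh.
by apply/flattenP; exists (supp t) => //; exact: map_f.
Qed.

Lemma all_okD_sub h h' D : {subset h <= h'} -> all (okD h) D -> all (okD h') D.
Proof. by move=> sub; apply: sub_all => P /andP[/(bp_sub sub) + ?]; rewrite /okD => ->. Qed.

Lemma all_costD_frame h h' D :
  {in flatten D, lev h' =1 lev h} -> all (okD h) D ->
  map (costD h') D = map (costD h) D.
Proof.
move=> lh /allP ok; apply/eq_in_map => P PD.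
have P0 : 0 < size P by case/andP: (ok P PD) => _ /andP[s _]; apply: leq_trans s.
have inD v : v \in P -> v \in flatten D by move=> vP; apply/flattenP; exists P.
by rewrite /costD !lh // inD ?head_mem ?last_mem.
Qed.

Lemma last_rev0 (P : seq nat) : last 0 (rev P) = head 0 P.
Proof. by case: P => //= x P; rewrite rev_cons last_rcons. Qed.

Lemma head_rev0 (P : seq nat) : head 0 (rev P) = last 0 P.
Proof. by rewrite -last_rev0 revK. Qed.

(** Only blue edges are added, so levels stay. A path end that becomes inner has level at most that
    of [act t], the new end, which takes over its charge; hence the cost grows by at least two per
    new blue edge. [gs] holds the inserted fresh vertices. *)
Lemma config_merge M M' h h' t U D Q P gs :
  config M h (t :: U) D Q -> wf h' -> bnd M' h' -> M <= M' ->
  {subset h <= h'} -> lev h' =1 lev h ->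
  (forall v, v \notin P -> nob h v -> nob h' v) -> bp h' P ->
  head 0 P = act t -> last 0 P = last 0 (pth t) ->
  size (pth t) < size P <= (size (pth t)).+2 ->
  perm_eq P (act t :: pth t ++ gs) -> uniq gs -> all (fun v => M <= v < M') gs ->
  config M' h' ((merge t P).1 ++ U) ((merge t P).2 ++ D) Q /\
  cost h t + 2 * (size P - size (pth t)) <=
    sumn (map (cost h') (merge t P).1) + sumn (map (costD h') (merge t P).2).
Proof.
case=> whf bh uv ltv /= /andP[okt okU] okDD bQ Q0 wf' bnd' MM sub lh nh bP hP lP sP pP ugs gsM.
have r2 : size (rest t) <= 2.
  by case/and5P: okt => _ _ _ _ /and3P[_ s _]; clear -s; lia.
have pv : perm_eq (verts ((merge t P).1 ++ U) ((merge t P).2 ++ D) Q)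
                  (gs ++ verts (t :: U) D Q).
  apply/permP => p; have /permP/(_ p) := perm_merge P r2.
  move/permP/(_ p): pP; rewrite /verts /= map_cat !flatten_cat.
  by clear; do 3 rewrite ?count_cat /=; lia.
have uv' : uniq (gs ++ verts (t :: U) D Q).
  rewrite cat_uniq ugs uv andbT; apply/hasPn => v /(allP ltv) vM.
  by apply/negP => /(allP gsM); rewrite leqNgt vM.
have vP v : v \in P -> (v \in act t :: pth t) || (M <= v).
  rewrite (perm_mem pP) -cat_cons mem_cat.
  by case/orP=> [->//|/(allP gsM)/andP[-> _]]; rewrite orbT.
have vE : verts (t :: U) D Q = (act t :: pth t) ++ (rest t ++ verts U D Q).
  by rewrite /verts /supp /= -!catA.
have notP v : v \in rest t ++ verts U D Q -> v \notin P.
  move=> vr; apply/negP => /vP /orP[vap|Mv].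
    by move: uv; rewrite vE cat_uniq => /and3P[_ /hasPn/(_ v vr)]; rewrite /= vap.
  have /(allP ltv) : v \in verts (t :: U) D Q by rewrite vE mem_cat vr orbT.
  by rewrite /= ltnNge Mv.
have nU v : v \in verts U D Q -> nob h v -> nob h' v.
  by move=> vv; apply: nh; apply: notP; rewrite mem_cat vv orbT.
have nr v : v \in rest t -> nob h v -> nob h' v.
  by move=> vr; apply: nh; apply: notP; rewrite mem_cat vr.
have okU' : all (okT h') U.
  apply: all_okT_frame okU => // v vU; apply: nU.
  by rewrite /verts mem_cat vU.
suff [okm okm' costm] : [/\ all (okT h') (merge t P).1,
   all (okD h') (merge t P).2 & cost h t + 2 * (size P - size (pth t)) <=
    sumn (map (cost h') (merge t P).1) + sumn (map (costD h') (merge t P).2)].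
  split=> //; split=> //.
  - by rewrite (perm_uniq pv).
  - rewrite (perm_all _ pv) all_cat; apply/andP; split.
      by apply: sub_all gsM => v /andP[].
    by apply: sub_all ltv => v vM; exact: leq_trans MM.
  - by rewrite all_cat okm.
  - by rewrite all_cat okm' (all_okD_sub sub).
  - exact: bp_sub bQ.
case: t okt hP lP sP nr {notP vP vE uv' pv r2 uv ltv pP} => [[x P0] r].
rewrite /okT /merge /okD /costD /cost /act /pth /rest /= => /and5P[nx nrr bP0 P00 /and3P[s3 s5 m]].
move=> hP lP /andP[sP sP'] nr.
case: r s3 s5 m nr nrr => [|a [|b [|]]] //= s3 s5 m nr nrr.
- split=> //; first by rewrite bP andbT; clear -s3 s5 sP sP'; lia.
  by rewrite !addn0 !lh hP lP; clear -s3 s5 sP sP' m; lia.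
- case/andP: m nrr => m1 m2 /andP[na _].
  rewrite nr ?inE // bp_rev bP size_rev head_rev0 last_rev0 hP lP !lh.
  by split=> //=; clear -s3 s5 sP sP' m1 m2; lia.
- case/and5P: m nrr => /andP[_ /eqP m0] /eqP m1 /eqP m2 m3 m4 /and3P[na nb _].
  rewrite !nr ?inE ?eqxx ?orbT // bP hP lP !lh.
  have -> : lev h (last 0 P0) = lev h (head 0 P0).
    by clear -m0; case: P0 m0 => // y [].
  by split=> //=; clear -m0 m1 m2 m3 m4 s3 s5 sP sP'; lia.
Qed.

(** * An unplayed move among many teams *)

Lemma pigeonhole (T : Type) (f : T -> nat) K m (s : seq T) :
  all (fun t => f t < K) s -> K * m < size s ->
  exists v, m < count (fun t => f t == v) s.
Proof.
move=> fK ms; apply: contrapT => none.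
have le v : count (fun t => f t == v) s <= m.
  by rewrite leqNgt; apply/negP => ?; apply: none; exists v.
move: ms; rewrite ltnNge => /negP; apply.
have <- : count (fun t => f t < K) s = size s by apply/eqP; rewrite -all_count.
elim: K {fK} => [|K IH]; first by rewrite mul0n leqn0 -leqn0 leqNgt -has_count has_pred0.
rewrite mulSn addnC; apply: leq_trans (leq_add IH (le K)).
by rewrite -count_predUI (leq_trans _ (leq_addr _ _)) // sub_count // => t /=; lia.
Qed.

Lemma config_perm M h U U' D Q : perm_eq U U' ->
  config M h U D Q -> config M h U' D Q.
Proof.
move=> UU [whf bh uv ltv ok okD' bQ Q0].
have pv : perm_eq (verts U D Q) (verts U' D Q).
  by rewrite /verts perm_cat2r; apply: perm_flatten; exact: perm_map.
by split=> //; [rewrite -(perm_uniq pv)|rewrite -(perm_all _ pv)|rewrite -(perm_all _ UU)].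
Qed.

Lemma uniq_map_flatten (T : eqType) (U : seq T) (F : T -> seq nat) (g : T -> nat) :
  {in U, forall t, g t \in F t} -> uniq (flatten (map F U)) -> uniq (map g U).
Proof.
elim: U => //= t U IH gF; rewrite cat_uniq => /and3P[_ /hasPn nF uF].
rewrite IH // ?andbT; last by move=> s sU; apply: gF; rewrite inE sU orbT.
apply/negP => /mapP[s sU E]; have /nF/negP : g s \in flatten (map F U).
  by apply/flattenP; exists (F s); [exact: map_f|apply: gF; rewrite inE sU orbT].
by apply; rewrite -E gF ?mem_head.
Qed.

Lemma nob_red h x y : nob h x -> mk_edge x y \in chosen h -> (mk_edge x y, red) \in h.
Proof.
move=> /allP nx /mapP[[e c] hin /= E]; rewrite E.
by case: c hin => // hin; have := nx _ hin; rewrite -E inc_mk_edge eqxx.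
Qed.

Definition put (t : team) (x : nat) : team := (x, pth t, rest t).

Lemma okT_put h t x : lev h x = lev h (act t) -> nob h x -> okT h t -> okT h (put t x).
Proof. by case: t => [[a P] r]; rewrite /okT /put /act /pth /rest /= => -> -> /andP[]. Qed.

Lemma cost_put h t x : lev h x = lev h (act t) -> cost h (put t x) = cost h t.
Proof. by case: t => [[a P] r]; rewrite /cost /put /act /pth /rest /= => ->. Qed.

(* Teams with the same [size (rest t)] and the same level of the active vertex
   may exchange their active vertices. *)
Lemma config_unplayed d M h U D Q : config M h U D Q ->
  ~ has_copy (star d.+1) red h -> 3 * d.+1 * d < size U ->
  exists t U', [/\ config M h (t :: U') D Q, (size U').+1 = size U,
    sumn (map (cost h) (t :: U')) = sumn (map (cost h) U) &
    mk_edge (act t) (head 0 (pth t)) \notin chosen h].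
Proof.
move=> cf ns sU; have whf := config_wf cf.
have levd v : lev h v <= d.
  by rewrite leqNgt; apply/negP => /(star_of_lev whf).
(* The size of [rest] and the active level are coded in base [d.+1]. There are [3 * d.+1] codes, so
   the assumed number of teams yields [d.+1] teams with one code. *)
pose key t := size (rest t) * d.+1 + lev h (act t).
have keyK : all (fun t => key t < 3 * d.+1) U.
  apply: sub_all (config_okT cf) => t; rewrite /okT /key => /and5P[_ _ _ _ /and3P[s3 s5 _]].
  have r2 : size (rest t) <= 2 by clear -s3 s5; lia.
  apply: leq_trans (_ : (size (rest t)).+1 * d.+1 <= _).
    by rewrite mulSn addnC addSn ltnS leq_add2r.
  by rewrite leq_mul2r ltnS r2 orbT.
have [v] := pigeonhole keyK sU.
set pv := (fun t => key t == v); rewrite -size_filter.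
have pU : perm_eq U (seq.filter pv U ++ seq.filter (predC pv) U).
  by rewrite perm_sym (permEl (perm_filterC _ _)).
have cB := config_perm pU cf.
have allB : all pv (seq.filter pv U) by exact: filter_all.
have sB := perm_size pU; have cstB := perm_sumn (perm_map (cost h) pU).
move: (seq.filter pv U) (seq.filter (predC pv) U) pU cB allB sB cstB => [|t0 B] C pU cB //=.
move=> /andP[k0 kB] sB cstB dB.
(* The active vertex of [t0] has no blue edge: were its edges to all [d.+1] path heads played, they
   would form a red star. *)
have [t1 [t1B unp]] : exists t1, t1 \in t0 :: B /\
    mk_edge (act t0) (head 0 (pth t1)) \notin chosen h.
  apply: contrapT => none; apply: ns.
  have gt0 t : t \in t0 :: B -> 0 < size (pth t).
    move=> tB; apply: (@okT_gt0 h); apply: (allP (config_okT cB)).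
    by rewrite mem_cat tB.
  have nx : nob h (act t0) by case/andP: (config_okT cB) => /andP[].
  have := config_uniq cB; rewrite /verts cat_uniq => /andP[+ _].
  rewrite map_cat flatten_cat cat_uniq => /andP[uB _].
  apply: (@star_of_neighbours d h (act t0) [seq head 0 (pth t) | t <- t0 :: B]).
  - by rewrite size_map.
  - apply: (@uniq_map_flatten _ _ supp (fun t => head 0 (pth t)) _ uB) => t tB; rewrite /supp inE mem_cat.
    by rewrite head_mem ?orbT // gt0.
  - apply/negP => /mapP[t tB E]; move: uB; rewrite /= => /andP[/negP xn _].
    apply: xn; rewrite E !mem_cat; move: tB; rewrite inE => /orP[/eqP->|tB].
      by rewrite head_mem // gt0 // mem_head.
    apply/orP; right; apply/flattenP; exists (supp t); first exact: map_f.
    by rewrite inE mem_cat head_mem ?orbT // gt0 // inE tB orbT.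
  - move=> w /mapP[t tB ->]; apply: nob_red nx _.
    by apply: contrapT => /negP unp; apply: none; exists t.
have [E|t10] := eqVneq t1 t0.
  by exists t0, (B ++ C); split=> //; move: unp; rewrite E.
have t1B' : t1 \in B by move: t1B; rewrite inE (negPf t10).
have pB : perm_eq (t0 :: B ++ C) [:: t1, t0 & rem t1 B ++ C].
  apply/permP => p; have /permP/(_ p) := perm_to_rem t1B'.
  by clear; rewrite /= !count_cat; lia.
have [whB bB uB lB okB okDB bQ Q0] := config_perm pB cB.
have klev : lev h (act t0) = lev h (act t1).
  have k01 : key t0 = key t1 by rewrite (eqP k0) (eqP (allP kB _ t1B')).
  have := congr1 (modn^~ d.+1) k01.
  by rewrite /key !modnMDl !modn_small ?ltnS.
have [ok1 ok0 okC] := and3P okB.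
have nx0 : nob h (act t0) by case/andP: ok0.
have nx1 : nob h (act t1) by case/andP: ok1.
have pv' : perm_eq (verts [:: t1, t0 & rem t1 B ++ C] D Q)
                   (verts [:: put t1 (act t0), put t0 (act t1) & rem t1 B ++ C] D Q).
  rewrite /verts perm_cat2r; clear; apply/permP => p; rewrite /supp /put /=.
  by do 3 rewrite ?count_cat /act /pth /rest /=; lia.
(* [t1] receives the active vertex of [t0], whose edge to the path head of [t1] is unplayed. *)
exists (put t1 (act t0)), (put t0 (act t1) :: rem t1 B ++ C); split=> //.
- split=> //; [by rewrite -(perm_uniq pv')|by rewrite -(perm_all _ pv')|].
  by apply/and3P; split; rewrite ?okT_put.
- by rewrite sB; have := perm_size pB; rewrite /= => ->.
- have := perm_sumn (perm_map (cost h) pB); rewrite /= in cstB *.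
  by rewrite cstB /= !cost_put // => ->.
Qed.

(** * Playing until one team is finished *)

Lemma force_step d G h x y : x != y -> mk_edge x y \notin chosen h ->
  force d G ((mk_edge x y, red) :: h) -> force d G ((mk_edge x y, blue) :: h) ->
  force d G h.
Proof. by move=> xy unp fr fb; apply: force_play (is_edge_mk xy) unp _; case. Qed.

Lemma force_blue d G h x y : wf h -> x != y -> mk_edge x y \notin chosen h ->
  d <= lev h x -> force d G ((mk_edge x y, blue) :: h) -> force d G h.
Proof.
move=> wh xy unp dx fb; apply: (force_step xy unp _ fb).
have wh2 := wf_cons red xy unp wh; apply: force_star.
apply: (@star_of_lev _ _ x wh2).
by rewrite lev_cons !eqxx.
Qed.

(** The long path has a fresh end: its edges stay inside [Q], so all edges from it to finished team
    paths are still available. *)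
Definition endQ (h : history) (Q : seq nat) : bool :=
  all (fun e : edge => inc (head 0 Q) e ==> (e.1 \in Q) && (e.2 \in Q)) (chosen h).

Lemma endQ_cons x y c h Q : x != head 0 Q -> y != head 0 Q -> endQ h Q ->
  endQ ((mk_edge x y, c) :: h) Q.
Proof. by move=> xf yf eQ; rewrite /endQ /= inc_mk_edge (negPf xf) (negPf yf). Qed.

(** Everything is scaled by ten: [cost] and [costD] count half edges, and each vertex of the long
    path pays for [(2 * d + 5) / 5] edges. *)
Definition budget (d : nat) (h : history) U D (Q : seq nat) : bool :=
  10 * size h <= 5 * sumn (map (cost h) U) + 5 * sumn (map (costD h) D) +
                 (4 * d + 10) * size Q.

Lemma subset_cons (T : eqType) (e : T) h : {subset h <= e :: h}.
Proof. by move=> z zh; rewrite inE zh orbT. Qed.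

Lemma lev_other x y c h v : v != x -> v != y ->
  lev ((mk_edge x y, c) :: h) v = lev h v.
Proof. by move=> vx vy; rewrite lev_cons ![_ == v]eq_sym (negPf vx) (negPf vy) andbF. Qed.

Lemma nob_other x y c h v : v != x -> v != y -> nob h v ->
  nob ((mk_edge x y, c) :: h) v.
Proof.
by move=> vx vy; rewrite nob_cons ![_ == v]eq_sym (negPf vx) (negPf vy) implybT.
Qed.

Lemma nob_redE e h v : nob ((e, red) :: h) v = nob h v. Proof. by []. Qed.

(** Both ends of the red edge belong to the team and are charged one unit each. Before the first
    blue edge the two pairs swap roles, which keeps their levels at most one apart. *)
Lemma config_red M h t U D Q (x := act t) (y := head 0 (pth t))
    (h' := (mk_edge x y, red) :: h) :
  config M h (t :: U) D Q -> mk_edge x y \notin chosen h ->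
  exists t', config M h' (t' :: U) D Q /\ cost h' t' = (cost h t).+2.
Proof.
case=> whf bh uv ltv /andP[okt okU] okDD bQ Q0 unp.
have sub : {subset h <= h'} by exact: subset_cons.
have P0 : 0 < size (pth t) := okT_gt0 okt.
have uvt : uniq (supp t ++ verts U D Q) by rewrite /verts catA.
have xt : x \in supp t by rewrite mem_head.
have yt : y \in supp t by rewrite inE mem_cat head_mem ?orbT.
have tM v : v \in supp t -> v < M.
  by move=> vt; apply: (allP ltv); rewrite /verts -catA mem_cat vt.
have [xM yM] := (tM x xt, tM y yt).
have out v : v \in verts U D Q -> (v != x) && (v != y).
  move=> vv; move: uvt; rewrite cat_uniq => /and3P[_ /hasPn/(_ v vv) vt _].
  by apply/andP; split; apply: contra vt => /eqP->.
have xy : x != y.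
  move: uvt; rewrite cat_uniq /supp /= => /andP[/andP[+ _] _].
  rewrite mem_cat => /norP[xP _]; apply: contra xP => /eqP xE.
  by rewrite -/x xE head_mem.
have okU' : all (okT h') U.
  apply: all_okT_frame (sub) _ _ okU => v vU.
    have /andP[vx vy] := out v ltac:(by rewrite /verts mem_cat vU).
    exact: lev_other.
  by rewrite nob_redE.
suff [t' [okt' pt' ct']] : exists t', [/\ okT h' t', perm_eq (supp t) (supp t') &
    cost h' t' = (cost h t).+2].
  exists t'; split=> //.
  have pv : perm_eq (verts (t :: U) D Q) (verts (t' :: U) D Q).
    exact: (perm_cat (perm_cat pt' (perm_refl _)) (perm_refl _)).
  split=> //.
  - exact: wf_cons.
  - exact: bnd_cons xM yM _ bh.
  - by rewrite -(perm_uniq pv).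
  - by rewrite -(perm_all _ pv).
  - exact/andP.
  - exact: all_okD_sub okDD.
  - exact: bp_sub bQ.
have levx : lev h' x = (lev h x).+1 by rewrite lev_cons !eqxx.
have levy : lev h' y = (lev h y).+1 by rewrite lev_cons !eqxx orbT.
have levr v : v \in rest t -> lev h' v = lev h v.
  move=> vr; apply: lev_other; apply/eqP => E; subst v.
    by move: uvt; rewrite cat_uniq /supp /= mem_cat vr orbT.
  move: uvt; rewrite cat_uniq /supp /= cat_uniq => /andP[/and4P[_ _ /hasPn/(_ _ vr)/negP yP _] _].
  by apply: yP; apply: head_mem.
have levl : 1 < size (pth t) -> lev h' (last 0 (pth t)) = lev h (last 0 (pth t)).
  move=> P1; have lP : last 0 (pth t) \in pth t by rewrite last_mem.
  apply: lev_other.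
    apply: contraNneq xy => E; move: uvt; rewrite cat_uniq /supp /= mem_cat.
    by rewrite /x -/x -E lP.
  move: uvt; rewrite cat_uniq /supp /= cat_uniq => /andP[/and3P[_ uP _] _].
  rewrite /y; case: (pth t) P1 uP => [|a [|b s]] //= _ /andP[+ _].
  by apply: contraNneq => <-; exact: mem_last.
have bpS P : bp h P -> bp h' P := @bp_sub _ _ P sub.
have nobS v : nob h' v = nob h v by [].
case: t @x @y h' okt {okU okU' uv ltv xt yt xM yM tM out uvt unp sub} bpS nobS P0 xy levx levy levr levl
  => [[x P] r]; rewrite /act /pth /rest /= => h' okt bpS nobS P0 xy levx levy levr levl.
move: okt; rewrite /okT /act /pth /rest /= => /and5P[nx nr bP _ /and3P[s3 s5 m]].
have bP' := bpS P bP.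
case: r nr s3 s5 m levr => [|a [|b [|]]] //= nr s3 s5 m levr.
- exists (x, P, [::]); rewrite /okT /cost /act /pth /rest /= nobS nx bP' P0 levx levy levl; last by clear -s3; lia.
  by split=> //; clear -s3 s5 m; lia.
- exists (x, P, [:: a]); rewrite /okT /cost /act /pth /rest /= !nobS nx bP' P0 levx levy levl; last by clear -s3; lia.
  rewrite levr ?inE // nr; split=> //; clear -s3 s5 m; lia.
- case/and5P: m => /andP[ny /eqP m0] /eqP m1 /eqP m2 m3 m4.
  case: P m0 m1 ny levy {levl bP bP' P0 s3 s5} xy levx levr => [|y []] //= _ m1 ny levy xy levx levr.
  case/and3P: nr => na nb _.
  exists (b, [:: a], [:: x; y]); rewrite /okT /cost /supp /act /pth /rest /=.
  rewrite !nobS nx ny na nb levx levy !levr ?inE ?eqxx ?orbT //; split=> //.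
  + clear -m1 m2 m3 m4; lia.
  + by clear; apply/permP => p /=; lia.
  + clear -m1 m2 m3 m4; lia.
Qed.

Lemma config_act M h t U D Q (x := act t) (y := head 0 (pth t)) (f := head 0 Q) :
  config M h (t :: U) D Q ->
  [/\ x != y, x != f, y != f & [/\ x < M, y < M & x \notin pth t]].
Proof.
case=> _ _ uv ltv /= /andP[/okT_gt0 P0 _] _ _ Q0.
have vE : verts (t :: U) D Q = (x :: pth t) ++ (rest t ++ flatten (map supp U) ++ flatten D) ++ Q.
  by rewrite /verts /supp /= -!catA.
have yP : y \in pth t by exact: head_mem.
have [xs ys] : x \in x :: pth t /\ y \in x :: pth t by rewrite mem_head inE yP orbT.
have lt v : v \in x :: pth t -> v < M.
  by move=> vs; apply: (allP ltv); rewrite vE mem_cat vs.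
have nf v : v \in x :: pth t -> v != f.
  move=> vs; apply/eqP => E; move: uv; rewrite vE cat_uniq => /and3P[_ /hasPn/(_ f) H _].
  by move: H; rewrite mem_cat head_mem // orbT /= -E vs => /(_ isT).
have xP : x \notin pth t by move: uv; rewrite vE /= mem_cat => /andP[/norP[]].
by split; rewrite ?nf ?lt //; apply: contra xP => /eqP->.
Qed.

Lemma cost_eq h h' : lev h' =1 lev h -> cost h' =1 cost h.
Proof. by move=> lh [[x P] r]; rewrite /cost !lh; case: r => [|a [|b []]] //=; rewrite !lh. Qed.

Lemma costD_eq h h' : lev h' =1 lev h -> costD h' =1 costD h.
Proof. by move=> lh P; rewrite /costD !lh. Qed.

(** Levels enter [cost] with total weight four, and a path inside a team has at most five vertices,
    hence four edges of weight two. *)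
Lemma sum_cost_le d h U : (forall v, lev h v <= d) -> all (okT h) U ->
  sumn (map (cost h) U) <= size U * (4 * d + 8).
Proof.
move=> levd; elim: U => //= t U IH /andP[okt /IH {}IH].
rewrite mulSn leq_add //.
move: okt; rewrite /okT /cost => /and5P[_ _ _ _ /and3P[s3 s5 _]].
have l1 := levd (act t); have l2 := levd (head 0 (pth t)).
have l3 := levd (last 0 (pth t)).
case: (rest t) s3 s5 => [|a [|b [|]]] s3 s5; rewrite /= in s3 s5 *.
- by clear -l1 l2 l3 s3 s5; lia.
- by have l4 := levd a; clear -l1 l2 l3 l4 s3 s5; lia.
- by have l4 := levd a; have l5 := levd b; clear -l1 l2 l3 l4 l5; lia.
- by [].
Qed.

Lemma sum_costD_le d h D : (forall v, lev h v <= d) -> all (okD h) D ->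
  sumn (map (costD h) D) <= size D * (4 * d + 12).
Proof.
move=> levd; elim: D => //= P D IH /andP[/andP[_ sP] /IH {}IH].
rewrite mulSn leq_add // /costD.
have l1 := levd (head 0 P); have l2 := levd (last 0 P).
by clear -l1 l2 sP; lia.
Qed.

(** In continuation form, like the lemmas on the later phases: [K] wins from every state in which
    the phase can end. Costs are bounded while no level exceeds [d], so [budget] bounds the length
    of the history, and running out of [fuel] is contradictory. *)
Lemma finish_team d G fuel M h U D Q :
  config M h U D Q -> endQ h Q -> budget d h U D Q -> 3 * d.+1 * d < size U ->
  5 * (size U * (4 * d + 8)) + 5 * sumn (map (costD h) D) + (4 * d + 10) * size Q
    < 10 * (size h + fuel) ->
  (forall M' h' U' P, config M' h' U' (P :: D) Q -> endQ h' Q ->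
     budget d h' U' (P :: D) Q -> (size U').+1 = size U -> force d G h') ->
  force d G h.
Proof.
elim: fuel M h U => [|fuel IH] M h U cf eQ bud sU fu K;
  have [st|ns] := pselect (has_copy (star d.+1) red h); try exact: force_star.
  have levd v : lev h v <= d.
    by rewrite leqNgt; apply/negP => /(star_of_lev (config_wf cf)).
  have cU := sum_cost_le levd (config_okT cf).
  by move: bud; rewrite /budget; clear -cU fu; lia.
have levd v : lev h v <= d.
  by rewrite leqNgt; apply/negP => /(star_of_lev (config_wf cf)).
have [t [U' [cft sU' cst unp]]] := config_unplayed cf ns sU.
have [xy xf yf [xM yM xP]] := config_act cft.
(* After a merge the result is either again a team, and the recursion goes on, or a finished path,
   handed to [K]. *)
have tail M' h' P : config M' h' ((merge t P).1 ++ U') ((merge t P).2 ++ D) Q ->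
    endQ h' Q -> lev h' =1 lev h -> size h < size h' ->
    cost h t + 2 * (size h' - size h) <=
      sumn (map (cost h') (merge t P).1) + sumn (map (costD h') (merge t P).2) ->
    force d G h'.
  move=> cf' eQ' lh lth cstm.
  have [cU' cD'] : map (cost h') U' = map (cost h) U' /\ map (costD h') D = map (costD h) D.
    by split; apply: eq_map; [exact: cost_eq|exact: costD_eq].
  have [[t' E]|E] : (exists t', merge t P = ([:: t'], [::])) \/ merge t P = ([::], [:: P]).
    by rewrite /merge; case: (rest t) => [|a [|b [|]]]; (try by right); left; eexists.
  - rewrite E /= in cf' cstm.
    apply: (IH M' h' (t' :: U') cf' eQ').
    + move: bud cst; rewrite /budget /= cU' cD'; clear -cstm lth; lia.
    + by rewrite /= sU'.
    + by rewrite /= sU' cD'; clear -fu lth; lia.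
    + by move=> M2 h2 U2 P2 c2 e2 b2 /= s2; apply: (K M2 h2 U2 P2) => //; rewrite s2 sU'.
  - rewrite E /= in cf' cstm.
    apply: (K M' h' U' P) => //.
    move: bud cst; rewrite /budget /= cU' cD'; clear -cstm lth; lia.
have bp0 : bp h (pth t) by case/andP: (config_okT cft) => /and5P[].
have P0 : 0 < size (pth t) by case/andP: (config_okT cft) => /okT_gt0.
have lyx : lev h (head 0 (pth t)) <= lev h (act t).
  case/andP: (config_okT cft) => /and5P[_ _ _ _ /and3P[_ _ m]] _.
  by case: (rest t) m => [|a [|b [|]]] // => [/andP[] //|/and5P[_ /eqP->]].
have wh := config_wf cft; have bh := config_bnd cft.
set x := act t in xy xf xM xP unp lyx *; set y := head 0 (pth t) in xy yf yM unp lyx *.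
(* If [y] is saturated then by [lyx] so is [x]; the edges from both to the fresh vertex [M] are
   forced blue, and the path grows by [x] and [M]. *)
have [dy|yd] := leqP d (lev h y).
  have fM : head 0 Q < M.
    by apply: (allP (config_lt cft)); rewrite /verts !mem_cat head_mem ?orbT // (config_gt0 cft).
  have [yg xg gf] : [/\ y != M, x != M & M != head 0 Q].
    by rewrite (ltn_eqF yM) (ltn_eqF xM) eq_sym (ltn_eqF fM).
  have unpy : mk_edge y M \notin chosen h by exact: unplayed_fresh bh (leqnn M).
  apply: (force_blue wh yg unpy dy); set h1 := _ :: h.
  have wh1 : wf h1 by exact: wf_cons.
  have unpx : mk_edge x M \notin chosen h1.
    rewrite inE negb_or (unplayed_fresh _ bh (leqnn M)) andbT.
    by apply: contra xy => /eqP; rewrite ![mk_edge _ M]mk_edgeC => /mk_edge_inj->.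
  have dx : d <= lev h1 x by apply: leq_trans dy _.
  apply: (force_blue wh1 xg unpx dx); set h2 := _ :: h1.
  have sub : {subset h <= h2} by move=> z zh; rewrite !inE zh !orbT.
  have [] := @config_merge M M.+1 h h2 t U' D Q (x :: M :: pth t) [:: M] cft => //.
  - exact: wf_cons.
  - by apply: (@bnd_cons M.+1) => //; [exact: ltnW|apply: (@bnd_cons M) => //; exact: ltnW].
  - move=> v; rewrite !inE !negb_or => /and3P[vx vg vP] nv.
    have vy : v != y by apply: contraNneq vP => ->; exact: head_mem.
    by apply: nob_other => //; exact: nob_other.
  - apply: bp_cons => [_|]; first by rewrite inE eqxx.
    apply: bp_cons => [_|]; last exact: bp_sub sub bp0.
    by rewrite mk_edgeC !inE eqxx orbT.
  - by case: (pth t) P0.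
  - by rewrite /=; clear; lia.
  - by clear; apply/permP => p; rewrite -/x /= count_cat /=; lia.
  - by rewrite /= leqnn ltnSn.
  move=> cf2 c2; apply: (tail _ _ _ cf2) => //.
  - by do 2 apply: endQ_cons => //.
  - by apply: leq_trans c2; rewrite /=; clear; lia.
apply: (force_step xy unp).
- have [t' [cf' ct']] := config_red cft unp.
  set h1 := _ :: h in cf' ct' *.
  have inV v : v \in verts U' D [::] -> lev h1 v = lev h v.
    rewrite /verts cats0 => vv; have := config_uniq cft.
    have -> : verts (t :: U') D Q =
        (x :: pth t) ++ (rest t ++ (flatten (map supp U') ++ flatten D) ++ Q).
      by rewrite /verts /supp /= -!catA.
    rewrite cat_uniq => /and3P[_ /hasPn/(_ v) H _].
    have {H} vn : v \notin x :: pth t by apply: H; rewrite !mem_cat -mem_cat vv orbT.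
    by apply: lev_other; apply: contraNneq vn => ->; rewrite inE ?eqxx ?head_mem ?orbT.
  have cU' : map (cost h1) U' = map (cost h) U'.
    apply: all_cost_frame; last by case/andP: (config_okT cft).
    by move=> v vU; apply: inV; rewrite /verts mem_cat vU.
  have cD' : map (costD h1) D = map (costD h) D.
    apply: all_costD_frame (config_okD cft).
    by move=> v vD; apply: inV; rewrite /verts cats0 mem_cat vD orbT.
  apply: (IH M h1 (t' :: U') cf').
  + exact: endQ_cons.
  + move: bud cst; rewrite /budget /= cU' cD' ct'; clear; lia.
  + by rewrite /= sU'.
  + by rewrite /= sU' cD'; clear -fu; lia.
  + by move=> M2 h2 U2 P2 c2 e2 b2 /= s2; apply: (K M2 h2 U2 P2) => //; rewrite s2 sU'.
- set h1 := _ :: h.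
  have sub : {subset h <= h1} by move=> z zh; rewrite inE zh orbT.
  have [] := @config_merge M M h h1 t U' D Q (x :: pth t) [::] cft => //.
  - exact: wf_cons.
  - exact: bnd_cons bh.
  - move=> v; rewrite !inE !negb_or => /andP[vx vP] nv.
    have vy : v != y by apply: contraNneq vP => ->; exact: head_mem.
    exact: nob_other.
  - apply: bp_cons => [_|]; first by rewrite inE eqxx.
    exact: bp_sub sub bp0.
  - by case: (pth t) P0.
  - by rewrite /=; clear; lia.
  - by rewrite cats0.
  move=> cf2 c2; apply: (tail _ _ _ cf2) => //.
  - exact: endQ_cons.
  - by apply: leq_trans c2; rewrite /=; clear; lia.
Qed.

(** * A supply of finished paths *)

Lemma config_new_team M h U D Q : config M h U D Q ->
  exists t, config M.+4 h (t :: U) D Q /\ cost h t = 0.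
Proof.
case=> whf bh uv ltv okU okDD bQ Q0.
pose t : team := (M, [:: M.+1], [:: M.+2; M.+3]).
have lev0 v : M <= v -> lev h v = 0 by exact: lev_fresh.
have nob0 v : M <= v -> nob h v by exact: nob_fresh.
have [l1 l2 [l3 l4]] : [/\ M <= M.+1, M <= M.+2 & M <= M.+3 /\ M <= M.+4].
  by split; [| |split]; clear; lia.
have vt : verts (t :: U) D Q = [:: M; M.+1; M.+2; M.+3] ++ verts U D Q by [].
exists t; split; last by rewrite /cost /t /act /pth /rest /= !lev0.
split=> //.
- by apply: sub_all bh => e eM; apply: leq_trans eM _.
- rewrite vt cat_uniq uv andbT; apply/andP; split.
    by clear; rewrite /= !inE; lia.
  apply/hasPn => v /(allP ltv) /= vM; clear -vM; rewrite !inE; lia.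
- rewrite vt all_cat; apply/andP; split; first by clear; rewrite /=; lia.
  by apply: sub_all ltv => v vM; apply: leq_trans vM _.
- rewrite /= okU andbT /okT /t /act /pth /rest /=.
  by rewrite !nob0 // !lev0.
Qed.

(** A reserve of [3 * d.+1 * d] teams is kept. One new team lifts the number above the pigeonhole
    threshold, and finishing a team restores the reserve. *)
Lemma add_done d G M h U D Q :
  config M h U D Q -> endQ h Q -> budget d h U D Q -> size U = 3 * d.+1 * d ->
  (forall M' h' U' P, config M' h' U' (P :: D) Q -> endQ h' Q ->
     budget d h' U' (P :: D) Q -> size U' = 3 * d.+1 * d -> force d G h') ->
  force d G h.
Proof.
move=> cf eQ bud sU K; have [t [cft ct]] := config_new_team cf.
have budt : budget d h (t :: U) D Q by rewrite /budget /= ct.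
apply: (@finish_team d G _ _ _ _ _ _ cft eQ budt).
- by rewrite /= sU.
(* The fuel only bounds the recursion; it is instantiated with the whole left side plus one. *)
- rewrite -[X in X < _]muln1; set X := (X in X * 1 < _).
  by apply: (@leq_trans (10 * (size h + X.+1))); [clear; lia|exact: leqnn].
- by move=> M' h' U' P cf' eQ' bud' /= [sU']; apply: (K M' h' U' P); rewrite // sU' sU.
Qed.

Lemma fill_done d G m M h U D Q :
  config M h U D Q -> endQ h Q -> budget d h U D Q -> size U = 3 * d.+1 * d ->
  (forall M' h' U' D', config M' h' U' D' Q -> endQ h' Q -> budget d h' U' D' Q ->
     size U' = 3 * d.+1 * d -> size D' = size D + m -> force d G h') ->
  force d G h.
Proof.
elim: m M h U D => [|m IH] M h U D cf eQ bud sU K.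
  by apply: (K M h U D); rewrite ?addn0.
apply: (add_done cf eQ bud sU) => M' h' U' P cf' eQ' bud' sU'.
apply: (IH _ _ _ _ cf' eQ' bud' sU') => M2 h2 U2 D2 cf2 eQ2 bud2 sU2 /= sD2.
by apply: (K M2 h2 U2 D2) => //; rewrite sD2 addSnnS.
Qed.

(** * Growing the long blue path *)

(** [D1] collects the paths whose heads already have a red edge to [f]. Each of them raised the
    level of [f], so among more than [d] paths a blue answer comes before the paths run out, or else
    a star appears. *)
Lemma attach d G M h U D1 D2 Q (f := head 0 Q) :
  config M h U (D1 ++ D2) Q -> budget d h U (D1 ++ D2) Q -> size D1 <= lev h f ->
  {in chosen h, forall e, inc f e ->
     (e.1 \in Q ++ map (head 0) D1) && (e.2 \in Q ++ map (head 0) D1)} ->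
  d < size (D1 ++ D2) ->
  (forall h' D' P, config M h' U D' (rev P ++ Q) -> 4 <= size P <= 7 ->
     (size D').+1 = size (D1 ++ D2) ->
     10 * size h' <= 5 * sumn (map (cost h') U) + 5 * sumn (map (costD h') D') +
       (4 * d + 10) * size Q + 10 * d + 10 * lev h' (last 0 P) + 10 * size P ->
     force d G h') ->
  force d G h.
Proof.
elim: D2 h D1 => [|P D2 IH] h D1 cf bud Df ef dD K.
  apply: force_star; apply: (@star_of_lev _ _ f (config_wf cf)).
  by rewrite cats0 in dD; exact: leq_trans Df.
have [st|ns] := pselect (has_copy (star d.+1) red h); first exact: force_star.
case: (cf) => whf bh uv ltv okU okDD bQ Q0.
have levd v : lev h v <= d.
  by rewrite leqNgt; apply/negP => /(star_of_lev whf).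
set a := head 0 P; set z := last 0 P.
have PD : P \in D1 ++ P :: D2 by rewrite mem_cat mem_head orbT.
have [bP /andP[s4 s7]] := andP (allP okDD _ PD).
have P0 : 0 < size P by exact: leq_trans s4.
have aP : a \in P := head_mem P0.
have fQ : f \in Q := head_mem Q0.
set U1 := flatten (map supp U) ++ flatten D1 ++ flatten D2.
have pv : perm_eq (verts U (D1 ++ P :: D2) Q) (P ++ U1 ++ Q).
  rewrite /verts /U1; clear; apply/permP => p; rewrite !flatten_cat /= !count_cat; lia.
have := uv; rewrite (perm_uniq pv) cat_uniq => /and3P[uP /hasPn nP uUQ].
have nPv v : v \in U1 ++ Q -> v \notin P by exact: nP.
have aQ : a \notin Q by apply: contraL aP => aQ; apply: nPv; rewrite mem_cat aQ orbT.
have fU v : v \in U1 -> v != f.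
  move: uUQ; rewrite cat_uniq => /and3P[_ /hasPn nQ _] vU.
  by apply: contraTneq vU => ->; exact: nQ.
have fP v : v \in P -> v != f.
  by apply: contraTneq => ->; apply: nPv; rewrite mem_cat fQ orbT.
have D1U v : v \in flatten D1 -> v \in U1 by rewrite !mem_cat => ->; rewrite orbT.
have D2U v : v \in flatten D2 -> v \in U1 by rewrite !mem_cat => ->; rewrite !orbT.
have TU v : v \in flatten (map supp U) -> v \in U1 by rewrite !mem_cat => ->.
have aU v : v \in U1 -> v != a.
  by move=> vU; apply: contraTneq aP => <-; apply: nPv; rewrite mem_cat vU.
have hD1 v : v \in map (head 0) D1 -> v \in U1.
  move=> /mapP[p pD ->]; apply: D1U; apply/flattenP; exists p => //.
  apply: head_mem; have := allP okDD p; rewrite mem_cat pD => /(_ isT).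
  by case/andP=> _ /andP[p4 _]; exact: leq_trans p4.
have unp : mk_edge f a \notin chosen h.
  apply/negP => /ef; rewrite inc_mk_edge eqxx => /(_ isT) H.
  have : a \in Q ++ map (head 0) D1.
    by move: H; rewrite /mk_edge /=; case: (leqP f a) => _ /andP[].
  rewrite mem_cat (negPf aQ) /= => /hD1/aU; by rewrite eqxx.
have fa : f != a by rewrite eq_sym fP.
have [fM aM] : f < M /\ a < M.
  by split; apply: (allP ltv); rewrite (perm_mem pv) !mem_cat ?fQ ?aP ?orbT.
have frame c v : v \in U1 -> lev ((mk_edge f a, c) :: h) v = lev h v.
  by move=> vU; apply: lev_other; [exact: fU|exact: aU].
have okU' c : all (okT ((mk_edge f a, c) :: h)) U.
  apply: all_okT_frame okU => [z' ? |v /TU vU|v /TU vU nv].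
  - by rewrite inE orbC; apply/orP; left.
  - exact: frame.
  - by apply: nob_other => //; [exact: fU|exact: aU].
have cU c : map (cost ((mk_edge f a, c) :: h)) U = map (cost h) U.
  by apply: all_cost_frame okU => v /TU; exact: frame.
have [okD1 okD2] : all (okD h) D1 /\ all (okD h) D2.
  by move: okDD; rewrite all_cat /= => /and3P[].
have cD1 c : map (costD ((mk_edge f a, c) :: h)) D1 = map (costD h) D1.
  by apply: all_costD_frame okD1 => v /D1U; exact: frame.
have cD2 c : map (costD ((mk_edge f a, c) :: h)) D2 = map (costD h) D2.
  by apply: all_costD_frame okD2 => v /D2U; exact: frame.
have za : z != a.
  rewrite /z /a; case: (P) s4 uP => [|p [|q s]] //= _ /andP[+ _].
  by apply: contraNneq => <-; exact: mem_last.
have zf : z != f by apply: fP; exact: last_mem.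
apply: (force_step fa unp).
  set h1 := _ :: h.
  have sub : {subset h <= h1} by exact: subset_cons.
  have eD : D1 ++ P :: D2 = (D1 ++ [:: P]) ++ D2 by rewrite -catA.
  rewrite eD in cf bud K dD okDD uv ltv *.
  apply: (IH h1 (D1 ++ [:: P])) => //.
  - split=> //; [exact: wf_cons|exact: bnd_cons bh|exact: okU'|exact: all_okD_sub okDD|exact: bp_sub bQ].
  (* The level of [a] rises by one and [costD] of its path by two: the path that was hit pays for
     the red edge. *)
  - move: bud; rewrite /budget !map_cat !sumn_cat /= cU cD1 cD2.
    rewrite /costD -/a -/z (lev_other _ _ zf za) lev_cons !eqxx orbT /=.
    by clear; lia.
  - by rewrite size_cat addn1 /h1 lev_cons !eqxx.
  - move=> e; rewrite inE => /orP[/eqP-> _|/ef H /H].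
      rewrite map_cat !mem_cat !inE; rewrite /mk_edge /=.
      by case: (leqP f a) => _; rewrite -/f fQ eqxx ?orbT.
    by rewrite map_cat catA ![_ \in _ ++ map _ [:: P]]mem_cat => /andP[-> ->].
set h1 := _ :: h.
have sub : {subset h <= h1} by exact: subset_cons.
apply: (K h1 (D1 ++ D2) P) => //.
- have pv' : perm_eq (verts U (D1 ++ P :: D2) Q) (verts U (D1 ++ D2) (rev P ++ Q)).
    rewrite /verts; clear; apply/permP => p.
    rewrite !flatten_cat /= !count_cat count_rev; lia.
  split=> //.
  + exact: wf_cons.
  + exact: bnd_cons bh.
  + by rewrite -(perm_uniq pv').
  + by rewrite -(perm_all _ pv').
  + exact: okU'.
  + by apply: all_okD_sub sub _; rewrite all_cat okD1.
  + apply: bp_cat; rewrite ?size_rev ?bp_rev //; try exact: bp_sub sub _.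
    by rewrite last_rev0 mk_edgeC inE eqxx.
  + by rewrite size_cat size_rev; apply: leq_trans P0 (leq_addr _ _).
- by rewrite s4 s7.
- by rewrite !size_cat /= addnS.
- have -> : lev h1 (last 0 P) = lev h z by [].
  move: bud; rewrite /budget !map_cat !sumn_cat /= cU cD1 cD2.
  have la := levd a; rewrite /costD -/a -/z.
  by clear -la P0; lia.
Qed.

(** At most [d] red answers at [z] are possible without a star. The new end [g] has no edge but the
    one to [z], which gives [endQ]. [B] is the part of the budget that this phase leaves alone. *)
Lemma extend d G B fuel M h U D Q (z := head 0 Q) :
  config M h U D Q -> d < lev h z + fuel ->
  10 * size h <= 5 * sumn (map (cost h) U) + 5 * sumn (map (costD h) D) + B +
                 10 * lev h z ->
  (forall M' h' g, config M' h' U D (g :: Q) -> endQ h' (g :: Q) ->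
     10 * size h' <= 5 * sumn (map (cost h') U) + 5 * sumn (map (costD h') D) + B +
                     10 * d + 10 ->
     force d G h') ->
  force d G h.
Proof.
elim: fuel M h => [|fuel IH] M h cf fu bud K.
  rewrite addn0 in fu.
  by apply: force_star; exact: (star_of_lev (config_wf cf) fu).
have [st|ns] := pselect (has_copy (star d.+1) red h); first exact: force_star.
case: (cf) => whf bh uv ltv okU okDD bQ Q0.
have levd v : lev h v <= d.
  by rewrite leqNgt; apply/negP => /(star_of_lev whf).
have zQ : z \in Q := head_mem Q0.
have zM : z < M by apply: (allP ltv); rewrite !mem_cat zQ !orbT.
have zg : z != M by rewrite (ltn_eqF zM).
have unp : mk_edge z M \notin chosen h by exact: unplayed_fresh bh (leqnn M).
set U1 := flatten (map supp U) ++ flatten D.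
have zU v : v \in U1 -> v != z.
  move: uv; rewrite /verts catA cat_uniq => /and3P[_ /hasPn nQ _] vU.
  by apply: contraTneq vU => ->; exact: nQ.
have gU v : v \in U1 -> v != M.
  move=> vU; suff: v < M by move=> vM; rewrite (ltn_eqF vM).
  by apply: (allP ltv); rewrite /verts catA mem_cat vU.
have frame c v : v \in U1 -> lev ((mk_edge z M, c) :: h) v = lev h v.
  by move=> vU; apply: lev_other; [exact: zU|exact: gU].
have TU v : v \in flatten (map supp U) -> v \in U1 by rewrite mem_cat => ->.
have DU v : v \in flatten D -> v \in U1 by rewrite mem_cat => ->; rewrite orbT.
have okU' c : all (okT ((mk_edge z M, c) :: h)) U.
  apply: all_okT_frame okU => [z' ? |v /TU vU|v /TU vU nv].
  - by rewrite inE orbC; apply/orP; left.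
  - exact: frame.
  - by apply: nob_other => //; [exact: zU|exact: gU].
have cU c : map (cost ((mk_edge z M, c) :: h)) U = map (cost h) U.
  by apply: all_cost_frame okU => v /TU; exact: frame.
have cD c : map (costD ((mk_edge z M, c) :: h)) D = map (costD h) D.
  by apply: all_costD_frame okDD => v /DU; exact: frame.
have bnd' c : bnd M.+1 ((mk_edge z M, c) :: h) by apply: bnd_cons bh => //; exact: ltnW.
have lt' : all (fun v => v < M.+1) (verts U D Q) by apply: sub_all ltv => v /ltnW.
apply: (force_step zg unp); set h1 := _ :: h;
  have sub : {subset h <= h1} by exact: subset_cons.
  have levz : lev h1 z = (lev h z).+1 by rewrite lev_cons !eqxx.
  apply: (IH M.+1 h1) => //.
  - split=> //; [exact: wf_cons|exact: bnd'|exact: okU'|exact: all_okD_sub okDD|exact: bp_sub bQ].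
  - by rewrite levz addSnnS.
  - by rewrite cU cD levz; clear -bud; rewrite /=; lia.
apply: (K M.+1 h1 M).
- have pv : perm_eq (verts U D (M :: Q)) (M :: verts U D Q).
    by rewrite /verts; clear; apply/permP => p; rewrite /= !count_cat /=; lia.
  split=> //.
  + exact: wf_cons.
  + exact: bnd'.
  + rewrite (perm_uniq pv) /= uv andbT; apply/negP => /(allP ltv).
    by rewrite /= ltnn.
  + by rewrite (perm_all _ pv) /= ltnSn lt'.
  + exact: okU'.
  + exact: all_okD_sub okDD.
  + apply: bp_cons => [_|]; last exact: bp_sub bQ.
    by rewrite mk_edgeC inE eqxx.
- apply/allP => e; rewrite inE => /orP[/eqP->|eh].
    rewrite inc_mk_edge eqxx orbT /= /mk_edge /=.
    by case: (leqP z M) => _; rewrite !inE zQ eqxx ?orbT.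
  have /mapP[ec ech ->] := eh.
  by rewrite (negPf (fresh_not_inc whf bh (leqnn M) ech)).
- by rewrite cU cD; have := levd z; clear -bud; rewrite /=; lia.
Qed.

(** Each turn refills the stock to [d.+1] finished paths, uses one of them and adds five to eight
    vertices to [Q], so the target [T] is exceeded by at most eight. *)
Lemma grow_path d G T m M h U D Q :
  config M h U D Q -> endQ h Q -> budget d h U D Q -> size U = 3 * d.+1 * d ->
  size D <= d.+1 -> size Q <= T + 8 -> T <= size Q + m ->
  (forall M' h' U' D' Q', config M' h' U' D' Q' -> budget d h' U' D' Q' ->
     size U' = 3 * d.+1 * d -> size D' <= d.+1 -> T <= size Q' <= T + 8 ->
     force d G h') ->
  force d G h.
Proof.
elim: m M h U D Q => [|m IH] M h U D Q cf eQ bud sU sD sQ Tm K.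
  by rewrite addn0 in Tm; apply: (K M h U D Q); rewrite ?Tm.
have [TQ|QT] := leqP T (size Q); first by apply: (K M h U D Q); rewrite ?TQ.
apply: (fill_done (m := d.+1 - size D) cf eQ bud sU) => {cf eQ bud sU} {}M {}h {}U D' cf eQ bud sU.
rewrite subnKC // => sD'.
apply: (@attach d G M h U [::] D' Q cf bud) => //.
- by move=> e /(allP eQ) /implyP H /H; rewrite cats0.
- by rewrite sD'.
move=> {cf eQ bud} {}h D2 P cf s47 sDD bud.
rewrite /= sD' in sDD; case: sDD => sDD.
have P0 : 0 < size P by case/andP: s47 => s _; exact: leq_trans s.
have hz : head 0 (rev P ++ Q) = last 0 P.
  rewrite -head_rev0; move: P0; rewrite -size_rev.
  by case: (rev P).
apply: (@extend d G ((4 * d + 10) * size Q + 10 * d + 10 * size P) d.+1 M h U D2 _ cf).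
- by rewrite hz; clear; lia.
- by rewrite hz; move: bud; clear; lia.
move=> {cf bud} {}M {}h g cf eQ bud.
have sQ' : size (g :: rev P ++ Q) = (size P + size Q).+1 by rewrite /= size_cat size_rev.
apply: (IH M h U D2 _ cf eQ) => //.
(* For a team path with [p] vertices this is [20 * d + 10 * (p + 1) <= (4 * d + 10) * (p + 1)],
   which rests on [4 <= p]. *)
- rewrite /budget sQ'; move: bud s47; clear; nia.
- by rewrite sDD.
- by rewrite sQ'; move: s47 QT; clear; lia.
- by rewrite sQ'; move: s47 Tm; clear; lia.
Qed.

(** * Closing the cycle and counting edges *)

Lemma cycle_copy h c : 0 < size c -> uniq c -> bp h c ->
  (mk_edge (last 0 c) (head 0 c), blue) \in h ->
  has_copy (cycle_graph (size c)) blue h.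
Proof.
move=> c0 uc bc lc; exists (fun i : 'I_(size c) => nth 0 c i) => [i j /eqP|].
  by rewrite nth_uniq // => /eqP/val_inj.
have next (i j : 'I_(size c)) : j == i.+1 %[mod size c] ->
    (mk_edge (nth 0 c i) (nth 0 c j), blue) \in h.
  rewrite modn_small // => /eqP ->; have := ltn_ord i.
  rewrite leq_eqVlt => /orP[/eqP E|ic].
    have iE : i = (size c).-1 :> nat by clear -E; lia.
    by rewrite E modnn iE nth_last nth0.
  by rewrite modn_small //; apply: (sortedP 0 bc).
move=> i j /= /andP[_ /orP[|]]; first exact: next.
by move=> /next; rewrite mk_edgeC.
Qed.

(* A vertex [u] blue to both [nth 0 Q i] and [nth 0 Q (i + m)] closes a
   blue cycle through the [m.+1] vertices of [Q] in between. *)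
Lemma close_cycle d G m Q u fuel h i :
  wf h -> bp h Q -> uniq Q -> u \notin Q -> d < m -> d + m < size Q ->
  i + fuel = d.+1 -> i <= lev h u ->
  (forall j, i <= j <= d -> (mk_edge u (nth 0 Q j) \notin chosen h) &&
                            (mk_edge u (nth 0 Q (j + m)) \notin chosen h)) ->
  (forall h', has_copy (cycle_graph m.+2) blue h' ->
     size h' <= size h + 2 * fuel -> G h') ->
  force d G h.
Proof.
elim: fuel h i => [|fuel IH] h i wh bQ uQ uN dm dmQ ifu iu unp K.
  (* Every failed pair has left a red edge at [u]; after [d.+1] failures there is a star. *)
  by apply: force_star; apply: (@star_of_lev _ _ u wh); rewrite -ifu addn0.
have id : i <= d by clear -ifu; lia.
have lt j : j <= d -> (j < size Q) && (j + m < size Q) by clear -dmQ; lia.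
have [iQ imQ] := andP (lt i id).
have neu j : j < size Q -> u != nth 0 Q j.
  by move=> jQ; apply: contra uN => /eqP->; exact: mem_nth.
have /andP[unp1 unp2] : (mk_edge u (nth 0 Q i) \notin chosen h) &&
    (mk_edge u (nth 0 Q (i + m)) \notin chosen h) by apply: unp; rewrite leqnn.
have diff a b : a < size Q -> b < size Q -> a != b ->
    mk_edge u (nth 0 Q a) != mk_edge u (nth 0 Q b).
  by move=> aQ bQ'; apply: contra => /eqP/mk_edge_inj/eqP; rewrite nth_uniq.
(* Since [d < m], the indices up to [d] and their shifts by [m] do not overlap, so playing pair [i]
   leaves the later pairs unplayed. *)
have far a b : i < a <= d -> b \in [:: i; i + m] ->
    (mk_edge u (nth 0 Q a) != mk_edge u (nth 0 Q b)) &&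
    (mk_edge u (nth 0 Q (a + m)) != mk_edge u (nth 0 Q b)).
  move=> ad; rewrite !inE => bi; have [bQ1 [aQ [aQ' [ab amb]]]] :
      b < size Q /\ a < size Q /\ a + m < size Q /\ a != b /\ a + m != b.
    by clear -ad bi dmQ dm; lia.
  by rewrite !diff.
apply: (force_step (neu i iQ) unp1); set h1 := _ :: h;
  have sub1 : {subset h <= h1} by exact: subset_cons.
  apply: (IH h1 i.+1) => //.
  - exact: wf_cons (neu i iQ) unp1 wh.
  - exact: bp_sub bQ.
  - by rewrite addSnnS.
  - by rewrite /h1 lev_cons !eqxx.
  - move=> j /andP[ij jd]; have /andP[n1 n2] := unp j ltac:(by rewrite (ltnW ij)).
    have /andP[f1 f2] := far j i ltac:(by rewrite ij) (mem_head _ _).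
    by rewrite /h1 /= !inE !negb_or n1 n2 f1 f2.
  - move=> h' ch' sh'; apply: K ch' _; apply: leq_trans sh' _.
    by rewrite /=; clear; lia.
have wh1 : wf h1 by exact: wf_cons (neu i iQ) unp1 wh.
have unp2' : mk_edge u (nth 0 Q (i + m)) \notin chosen h1.
  rewrite inE negb_or unp2 andbT; apply: diff => //; clear -dm; lia.
apply: (force_step (neu _ imQ) unp2'); set h2 := _ :: h1;
  have sub2 : {subset h1 <= h2} by exact: subset_cons.
  apply: (IH h2 i.+1) => //.
  - exact: wf_cons (neu _ imQ) unp2' wh1.
  - by apply: bp_sub sub2 _; exact: bp_sub bQ.
  - by rewrite addSnnS.
  - by rewrite /h2 lev_cons !eqxx.
  - move=> j /andP[ij jd]; have /andP[n1 n2] := unp j ltac:(by rewrite (ltnW ij)).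
    have /andP[f1 f2] := far j i ltac:(by rewrite ij) (mem_head _ _).
    have /andP[f3 f4] := far j (i + m) ltac:(by rewrite ij) ltac:(by rewrite !inE eqxx orbT).
    by rewrite /h2 /h1 /= !inE !negb_or n1 n2 f1 f2 f3 f4.
  - move=> h' ch' sh'; apply: K ch' _; apply: leq_trans sh' _.
    by rewrite /=; clear; lia.
apply: force_now; apply: K; last by rewrite /=; clear; lia.
set c := take m.+1 (drop i Q).
have sc : size c = m.+1.
  by rewrite size_takel // size_drop; clear -imQ; lia.
have hc : head 0 c = nth 0 Q i by rewrite -nth0 nth_take // nth_drop addn0.
have lc : last 0 c = nth 0 Q (i + m) by rewrite -nth_last sc nth_take // nth_drop.
have -> : m.+2 = size (u :: c) by rewrite /= sc.
have uc : u \notin c by apply: contra uN => /mem_take/mem_drop.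
apply: cycle_copy => //.
- by rewrite /= uc take_uniq // drop_uniq.
- apply: bp_cons => [_|].
    by rewrite hc; apply: sub2; rewrite inE eqxx.
  apply: take_sorted; apply: drop_sorted.
  by apply: bp_sub sub2 _; exact: bp_sub bQ.
- have -> : last 0 (u :: c) = last 0 c by case: (c) sc.
  by rewrite lc /= mk_edgeC inE eqxx.
Qed.

Lemma online_ramsey_le d : exists C, forall n, d.+3 <= n ->
  10 * online_ramsey (star d.+1) (cycle_graph n) <= (4 * d + 10) * n + C.
Proof.
pose N := 3 * d.+1 * d.
(* In order: the reserve teams, the at most [d.+1] finished paths left over, the at most [d + 8]
   vertices of [Q] beyond [n], and the [2 * d.+1] closing edges. *)
exists (5 * (N * (4 * d + 8)) + 5 * (d.+1 * (4 * d + 12)) +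
        (4 * d + 10) * (d + 8) + 20 * d.+1).
move=> [|[|m]] // dm; set C := (X in _ <= _ + X).
pose t := ((4 * d + 10) * m.+2 + C) %/ 10.
apply: (@leq_trans (10 * t)); last by rewrite mulnC leq_divM.
rewrite leq_pmul2l //; apply: (online_ramseyP _ _).2.
apply: force_builder_wins; set G := (fun h : history => _).
have [M [U [cf sU]]] : exists M U, config M [::] U [::] [:: 0] /\ size U = N.
  elim: (N) => [|p [M [U [cf sU]]]]; first by exists 1, [::].
  by have [u [cu _]] := config_new_team cf; exists M.+4, (u :: U); rewrite /= sU.
apply: (@grow_path d G (m.+2 + d) (m.+2 + d) M [::] U [::] [:: 0] cf) => //.
move=> {cf sU} {}M h {}U D Q cf bud sU sD /andP[TQ QT].
have [st|ns] := pselect (has_copy (star d.+1) red h); first exact: force_star.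
case: (cf) => whf bh uv ltv okU okDD bQ Q0.
have levd v : lev h v <= d.
  by rewrite leqNgt; apply/negP => /(star_of_lev whf).
have cU := sum_cost_le levd okU; have cD := sum_costD_le levd okDD.
have uQ : uniq Q by move: uv; rewrite /verts catA cat_uniq => /and3P[].
have MQ : M \notin Q.
  apply/negP => MQ; have /(allP ltv) : M \in verts U D Q by rewrite !mem_cat MQ !orbT.
  by rewrite /= ltnn.
apply: (@close_cycle d G m Q M d.+1 h 0) => //.
- by clear -TQ; lia.
- by move=> j _; rewrite ![mk_edge M _]mk_edgeC !(unplayed_fresh _ bh).
move=> h' ch' sh'; split=> //; rewrite leq_divRL // mulnC.
have cD' : size D * (4 * d + 12) <= d.+1 * (4 * d + 12) by rewrite leq_mul2r sD orbT.
have cQ : (4 * d + 10) * size Q <= (4 * d + 10) * (m.+2 + (d + 8)).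
  by rewrite leq_mul2l addnA QT orbT.
rewrite sU in cU; move: bud; rewrite /budget /C; rewrite mulnDr in cQ.
by rewrite /N; move: cU cD cD' cQ sh'; clear; lia.
Qed.

(** * The asymptotic bound *)

Import Order.TTheory GRing.Theory Num.Theory.
Import numFieldNormedType.Exports.
Local Open Scope classical_set_scope.
Local Open Scope ring_scope.

Theorem corollary1p3 (R : realType) (k : nat) (hk : (0 < k)%N) :
  exists eps : nat -> R,
    (eps n @[n --> \oo] --> (0 : R)) /\
    forall n : nat, (3 <= n)%N ->
      (online_ramsey (star k) (cycle_graph n))%:R
        <= ((2 * k%:R + 4) / 5 + eps n) * n%:R.
Proof.
case: k hk => // d _; have [C leC] := online_ramsey_le d.
pose r n := online_ramsey (star d.+1) (cycle_graph n).
(* The sum covers the finitely many [n] below [d.+3], to which [leC] does not apply. The error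
   [K * harmonic n * n] is at least [K / 2], because [n + 1 <= 2 * n]. *)
pose K : nat := (2 * (C + \sum_(i < d.+3) r i))%N.
exists (fun n => K%:R * harmonic n); split.
  rewrite -[0](mulr0 (K%:R : R)).
  by apply: cvgM; [exact: cvg_cst|exact: cvg_harmonic].
move=> n n3; rewrite -/(r n).
have rK : (10 * r n <= (4 * d + 10) * n + 5 * K)%N.
  rewrite /K; have [nd|dn] := ltnP n d.+3; last by have := leC n dn; rewrite -/(r n); lia.
  have : (r n <= \sum_(i < d.+3) r i)%N by rewrite (bigD1 (Ordinal nd)) //= leq_addr.
  by lia.
have n0 : (0 : R) < n.+1%:R by rewrite ltr0n.
have h1 : K%:R <= 2 * (K%:R * harmonic n * n%:R) :> R.
  have -> : 2 * (K%:R * harmonic n * n%:R) = K%:R * (2 * n%:R) / n.+1%:R :> R.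
    by rewrite /harmonic /=; ring.
  rewrite ler_pdivlMr // ler_wpM2l //.
  by rewrite -natrM ler_nat; lia.
(* With [k = d + 1] the rate here is [(2 * k + 3) / 5]; as [n] is nonnegative, it lies within the
   claimed [(2 * k + 4) / 5]. *)
have h2 : 10 * (r n)%:R <= (4 * d%:R + 10) * n%:R + 5 * K%:R :> R.
  by move: rK; rewrite -(ler_nat R) !(natrD, natrM).
rewrite -natr1.
have h3 : 0 <= n%:R :> R by [].
lra.
Qed.
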